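(* For any $\alpha\in(0,1)$ and any $p,q>0$ there exist positive definite $2\times2$ matrices $A,B$ such that $SG_{\alpha,p}(A,B)\not\le_{\mathrm{chao}}\mathcal{A}_{\alpha,q}(A,B)$ (hence $SG_{\alpha,p}(A,B)\not\le\mathcal{A}_{\alpha,q}(A,B)$).
   Context: For positive definite $A,B$: $A\#B:=A^{1/2}(A^{-1/2}BA^{-1/2})^{1/2}A^{1/2}$; $F_\alpha(A,B):=(A^{-1}\#B)^\alpha A(A^{-1}\#B)^\alpha$ (weighted spectral geometric mean); $SG_{\alpha,p}(A,B):=F_\alpha(A^p,B^p)^{1/p}$; $\mathcal{A}_{\alpha,q}(A,B):=((1-\alpha)A^q+\alpha B^q)^{1/q}$. For positive definite $X,Y$, $X\le Y$ is the Loewner order and $X\le_{\mathrm{chao}}Y$ (chaotic order) means $\log X\le\log Y$. *)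

(* Defs.v *)
From HB Require Import structures.
From mathcomp Require Import all_boot all_order all_algebra.
From mathcomp Require Import all_classical all_reals all_analysis.
Set Implicit Arguments. Unset Strict Implicit. Unset Printing Implicit Defensive.
Import Order.TTheory GRing.Theory Num.Theory.
Local Open Scope ring_scope.

Section Defs.
Variable R : realType.
Notation M := 'M[R]_2.

Definition posdef (A : M) : Prop :=
  A^T = A /\ forall v : 'cV[R]_2, v != 0 -> 0 < (v^T *m A *m v) 0 0.

Definition loewner_le (X Y : M) : Prop :=
  forall v : 'cV[R]_2, 0 <= (v^T *m (Y - X) *m v) 0 0.

Definition disc (A : M) : R := Num.sqrt ((\tr A) ^+ 2 - 4 * \det A).
Definition lam1 (A : M) : R := (\tr A + disc A) / 2.
Definition lam2 (A : M) : R := (\tr A - disc A) / 2.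

(* functional calculus for 2x2 symmetric matrices, via Lagrange
   interpolation on the spectrum (= Q diag(f(lam)) Q^T) *)
Definition mfun (f : R -> R) (A : M) : M :=
  if lam1 A == lam2 A then f (lam1 A) *: 1%:M
  else (f (lam1 A) / (lam1 A - lam2 A)) *: (A - (lam2 A)%:M)
     + (f (lam2 A) / (lam2 A - lam1 A)) *: (A - (lam1 A)%:M).

Definition mpow (r : R) (A : M) : M := mfun (fun x => powR x r) A.
Definition mlog (A : M) : M := mfun (@ln R) A.

Definition chao_le (X Y : M) : Prop := loewner_le (mlog X) (mlog Y).

Definition gmean (A B : M) : M :=
  mpow (1/2) A *m mpow (1/2) (mpow (-(1/2)) A *m B *m mpow (-(1/2)) A)
    *m mpow (1/2) A.

Definition Fsg (a : R) (A B : M) : M :=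
  mpow a (gmean (invmx A) B) *m A *m mpow a (gmean (invmx A) B).

Definition SG (a p : R) (A B : M) : M :=
  mpow (1/p) (Fsg a (mpow p A) (mpow p B)).

Definition Amean (a q : R) (A B : M) : M :=
  mpow (1/q) ((1 - a) *: mpow q A + a *: mpow q B).

End Defs.

(* Main.v *)
(* Fix [F] and [G] positive definite and put [P = G^-a F G^-a],
   [Q = G^(1-a) F G^(1-a)]; then [P^-1 # Q = G] and [F_a(P, Q) = F], so that
   [A = P^(1/p)], [B = Q^(1/p)] give [SG_{a,p}(A, B) = F^(1/p)]. Take
   [F = diag(l^(2a), l^(2a-2))] and [G] with eigenvalues [l], [l g] along
   [(c, s)] and its orthogonal, where [c] and [g] are small and [l] is large.
   Then [P <= g^(-2a)], while [Q] has one eigenvalue at most [1] and one of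
   order [l^2], so the least eigenvalue of [M = (1-a) P^(q/p) + a Q^(q/p)] is
   bounded independently of [l], and its unit eigenvector [z] is almost
   orthogonal to [G^(1-a) e1], which is nearly parallel to [(c, s)]. As [c] is
   small, [z] is close to [e1], namely [z1^2 <= a/2]. Hence
   [z^T (log F) z = (2a - 2 z1^2) log l >= a log l] and
   [z^T F^(1/p) z >= l^(2a/p) / 2] both tend to infinity with [l], whereas
   [log M] and [M^(1/q)] stay bounded at [z]. *)

Require Import Defs.
From HB Require Import structures.
From mathcomp Require Import all_boot all_order all_algebra.
From mathcomp Require Import all_classical all_reals all_analysis.
From mathcomp Require Import ring lra.
Import Order.TTheory GRing.Theory Num.Theory.
Local Open Scope ring_scope.
Set Implicit Arguments. Unset Strict Implicit. Unset Printing Implicit Defensive.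

(** * Real symmetric 2x2 matrices in an orthonormal eigenbasis and their functional calculus *)

Section SpectralForm.
Variable R : realType.
Implicit Types (c s x y : R) (X Y : 'M[R]_2) (v : 'cV[R]_2).

Definition qform X v : R := (v^T *m X *m v) 0 0.

(* For [c^2 + s^2 = 1] this is [x w w^T + y w' w'^T] with [w = (c, s)] and
   [w' = (-s, c)]. *)
Definition spectral c s x y : 'M[R]_2 :=
  \matrix_(i, j) if i == 0 then if j == 0 then x * c ^+ 2 + y * s ^+ 2
                                else (x - y) * (c * s)
                 else if j == 0 then (x - y) * (c * s)
                      else x * s ^+ 2 + y * c ^+ 2.

Lemma mx2P (m : nat) (X Y : 'M[R]_(2, m)) :
  (forall j, X 0 j = Y 0 j) -> (forall j, X 1 j = Y 1 j) -> X = Y.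
Proof.
move=> h0 h1; apply/matrixP => i j; case: i => -[|[|//]] Hi.
  by rewrite (_ : Ordinal Hi = 0) ?h0 //; apply: val_inj.
by rewrite (_ : Ordinal Hi = 1) ?h1 //; apply: val_inj.
Qed.

Lemma mulmx2E (m n : nat) (X : 'M[R]_(m, 2)) (Y : 'M[R]_(2, n)) i j :
  (X *m Y) i j = X i 0 * Y 0 j + X i 1 * Y 1 j.
Proof.
rewrite mxE !big_ord_recl big_ord0 addr0.
by rewrite (_ : lift ord0 ord0 = 1) //; apply: val_inj.
Qed.

Lemma mx2_eq X Y : X 0 0 = Y 0 0 -> X 0 1 = Y 0 1 -> X 1 0 = Y 1 0 ->
  X 1 1 = Y 1 1 -> X = Y.
Proof.
move=> h00 h01 h10 h11; apply: mx2P => -[[|[|//]] Hj].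
- by rewrite (_ : Ordinal Hj = 0) ?h00 //; apply: val_inj.
- by rewrite (_ : Ordinal Hj = 1) ?h01 //; apply: val_inj.
- by rewrite (_ : Ordinal Hj = 0) ?h10 //; apply: val_inj.
- by rewrite (_ : Ordinal Hj = 1) ?h11 //; apply: val_inj.
Qed.

Lemma qformE X v : qform X v =
  X 0 0 * v 0 0 ^+ 2 + (X 0 1 + X 1 0) * (v 0 0 * v 1 0) + X 1 1 * v 1 0 ^+ 2.
Proof. by rewrite /qform !mulmx2E !mxE; ring. Qed.

Lemma qformD X Y v : qform (X + Y) v = qform X v + qform Y v.
Proof. by rewrite !qformE !mxE; ring. Qed.

Lemma qformB X Y v : qform (X - Y) v = qform X v - qform Y v.
Proof. by rewrite !qformE !mxE; ring. Qed.

Lemma qformZ x X v : qform (x *: X) v = x * qform X v.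
Proof. by rewrite !qformE !mxE; ring. Qed.

Lemma qform_congr X Y v : Y^T = Y -> qform (Y *m X *m Y) v = qform X (Y *m v).
Proof. by move=> symY; rewrite /qform trmx_mul symY !mulmxA. Qed.

Lemma qform_spectral c s x y v : qform (spectral c s x y) v =
  x * (c * v 0 0 + s * v 1 0) ^+ 2 + y * (c * v 1 0 - s * v 0 0) ^+ 2.
Proof. by rewrite qformE !mxE /=; ring. Qed.

Lemma trmx_spectral c s x y : (spectral c s x y)^T = spectral c s x y.
Proof. by apply: mx2_eq; rewrite !mxE. Qed.

Lemma mxtrace2 X : \tr X = X 0 0 + X 1 1.
Proof.
rewrite /mxtrace !big_ord_recl big_ord0 addr0.
by rewrite (_ : lift ord0 ord0 = 1) //; apply: val_inj.
Qed.

Lemma det2 X : \det X = X 0 0 * X 1 1 - X 0 1 * X 1 0.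
Proof.
rewrite (expand_det_row _ 0) !big_ord_recl big_ord0 addr0 /cofactor !det_mx11.
rewrite !mxE /= expr0 expr1 mul1r mulN1r mulrN.
by congr (_ * X _ _ - X _ _ * X _ _); apply: val_inj.
Qed.

Lemma mxtrace_spectral c s x y : c ^+ 2 + s ^+ 2 = 1 ->
  \tr (spectral c s x y) = x + y.
Proof.
move=> cs1; rewrite mxtrace2 !mxE /=.
transitivity ((x + y) * (c ^+ 2 + s ^+ 2)); first by ring.
by rewrite cs1 mulr1.
Qed.

Lemma det_spectral c s x y : c ^+ 2 + s ^+ 2 = 1 ->
  \det (spectral c s x y) = x * y.
Proof.
move=> cs1; rewrite det2 !mxE /=.
transitivity (x * y * (c ^+ 2 + s ^+ 2) ^+ 2); first by ring.
by rewrite cs1 expr1n mulr1.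
Qed.

Lemma spectral_scalar c s x : c ^+ 2 + s ^+ 2 = 1 -> spectral c s x x = x%:M.
Proof.
move=> cs1; have cs1' : s ^+ 2 + c ^+ 2 = 1 by rewrite addrC.
by apply: mx2_eq; rewrite !mxE /= ?subrr ?mul0r // -mulrDr ?cs1 ?cs1' mulr1.
Qed.

Lemma mul_spectral c s x y x' y' : c ^+ 2 + s ^+ 2 = 1 ->
  spectral c s x y *m spectral c s x' y' = spectral c s (x * x') (y * y').
Proof.
move=> cs1; have s2 : s ^+ 2 = 1 - c ^+ 2 by rewrite -cs1; ring.
by apply: mx2_eq; rewrite mulmx2E !mxE /=; ring: s2.
Qed.

(** The discriminant is [(x - y)^2], so [lam1] and [lam2] are [x] and [y] in decreasing order;
    Lagrange interpolation is symmetric in its nodes, hence the same result in either order. *)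
Lemma mfun_spectral (f : R -> R) c s x y : c ^+ 2 + s ^+ 2 = 1 ->
  Defs.mfun f (spectral c s x y) = spectral c s (f x) (f y).
Proof.
move=> cs1; have s2 : s ^+ 2 = 1 - c ^+ 2 by rewrite -cs1; ring.
have discE : disc (spectral c s x y) = `|x - y|.
  rewrite /disc mxtrace_spectral // det_spectral // -sqrtr_sqr.
  by congr Num.sqrt; ring.
rewrite /Defs.mfun /lam1 /lam2 discE mxtrace_spectral //.
case: (ltrgtP x y) => [xy|yx|->]; last first.
- rewrite addr0 subr0 eqxx spectral_scalar // scalemx1.
  by congr (f _)%:M; field.
- have -> : (x + y + (x - y)) / 2 = x by field.
  have -> : (x + y - (x - y)) / 2 = y by field.
  rewrite gt_eqF //.
  have d1 : x - y != 0 by rewrite subr_eq0 gt_eqF.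
  have d2 : y - x != 0 by rewrite subr_eq0 lt_eqF.
  by apply: mx2_eq; rewrite !mxE /= ?mulr1n ?mulr0n; field: s2; rewrite ?d1 ?d2.
- have -> : (x + y + (y - x)) / 2 = y by field.
  have -> : (x + y - (y - x)) / 2 = x by field.
  rewrite gt_eqF //.
  have d1 : x - y != 0 by rewrite subr_eq0 lt_eqF.
  have d2 : y - x != 0 by rewrite subr_eq0 gt_eqF.
  by apply: mx2_eq; rewrite !mxE /= ?mulr1n ?mulr0n; field: s2; rewrite ?d1 ?d2.
Qed.

Lemma symmetric_spectral X : X^T = X ->
  exists c s x y, [/\ c ^+ 2 + s ^+ 2 = 1, y <= x & X = spectral c s x y].
Proof.
move=> symX; have X10 : X 1 0 = X 0 1 by rewrite -[in LHS]symX mxE.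
set u := X 0 0; set t := X 0 1; set d := X 1 1.
have [t0|t0] := eqVneq t 0.
  have [du|ud] := leP d u.
    exists 1, 0, u, d; split => //; first by ring.
    by apply: mx2_eq; rewrite ?X10 !mxE /= -/u -/t -/d ?t0; ring.
  exists 0, 1, d, u; split; [by ring|exact: ltW|].
  by apply: mx2_eq; rewrite ?X10 !mxE /= -/u -/t -/d ?t0; ring.
(* [D] is the gap between the eigenvalues. The vector [(t, m)] is an eigenvector for [u + m] exactly
   when [m^2 + m (u - d) = t^2], and the trace then makes [d - m] the other eigenvalue. *)
pose D := Num.sqrt ((u - d) ^+ 2 + 4 * t ^+ 2).
have D2 : D ^+ 2 = (u - d) ^+ 2 + 4 * t ^+ 2.
  by rewrite sqr_sqrtr // addr_ge0 ?sqr_ge0 // mulr_ge0 ?sqr_ge0 ?ler0n.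
have D0 : 0 <= D by exact: sqrtr_ge0.
pose m := (D - (u - d)) / 2.
have m2 : m ^+ 2 + m * (u - d) = t ^+ 2.
  by rewrite /m; field: D2.
have n0 : 0 < t ^+ 2 + m ^+ 2.
  by rewrite ltr_wpDr ?sqr_ge0 // exprn_even_gt0.
pose n := Num.sqrt (t ^+ 2 + m ^+ 2).
have n2 : n ^+ 2 = t ^+ 2 + m ^+ 2 by rewrite sqr_sqrtr // ltW.
have nn0 : n != 0 by rewrite gt_eqF // sqrtr_gt0.
exists (t / n), (m / n), (u + m), (d - m); split.
- by field: n2.
- by rewrite -subr_ge0 (_ : _ - _ = D) // /m; field.
have m2' : m ^+ 2 = t ^+ 2 - m * (u - d) by rewrite -m2; ring.
have n2' : n ^+ 2 = 2 * t ^+ 2 - m * (u - d) by rewrite n2 m2'; ring.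
by apply: mx2_eq; rewrite ?X10 !mxE /= -/u -/t -/d; field: n2' m2'.
Qed.

End SpectralForm.

(** * Positive definiteness, real powers and the spectral geometric mean *)

Section PositiveDefinite.
Variable R : realType.
Implicit Types (a c s x y r t : R) (X Y : 'M[R]_2) (v : 'cV[R]_2).

Definition sqnorm v : R := v 0 0 ^+ 2 + v 1 0 ^+ 2.

Definition vec2 x y : 'cV[R]_2 := \col_i (if i == 0 then x else y).

Lemma sqnorm_gt0 v : (0 < sqnorm v) = (v != 0).
Proof.
rewrite lt_neqAle addr_ge0 ?sqr_ge0 // andbT eq_sym; congr (~~ _).
rewrite paddr_eq0 ?sqr_ge0 // !sqrf_eq0; apply/andP/eqP => [[/eqP v0 /eqP v1]|->].
  by apply: mx2P => j; rewrite (ord1 j) mxE.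
by rewrite !mxE.
Qed.

Lemma sqnorm_vec2 x y : sqnorm (vec2 x y) = x ^+ 2 + y ^+ 2.
Proof. by rewrite /sqnorm !mxE. Qed.

Lemma sqnorm_rot c s v : c ^+ 2 + s ^+ 2 = 1 ->
  (c * v 0 0 + s * v 1 0) ^+ 2 + (c * v 1 0 - s * v 0 0) ^+ 2 = sqnorm v.
Proof.
move=> cs1; transitivity ((c ^+ 2 + s ^+ 2) * sqnorm v); last by rewrite cs1 mul1r.
by rewrite /sqnorm; ring.
Qed.

Lemma qform_spectral_le c s x y v : c ^+ 2 + s ^+ 2 = 1 -> y <= x ->
  qform (spectral c s x y) v <= x * sqnorm v.
Proof.
move=> cs1 yx; rewrite qform_spectral -(sqnorm_rot v cs1) mulrDr lerD2l.
by rewrite ler_wpM2r ?sqr_ge0.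
Qed.

Lemma qform_spectral_ge c s x y v : c ^+ 2 + s ^+ 2 = 1 -> y <= x ->
  y * sqnorm v <= qform (spectral c s x y) v.
Proof.
move=> cs1 yx; rewrite qform_spectral -(sqnorm_rot v cs1) mulrDr lerD2r.
by rewrite ler_wpM2r ?sqr_ge0.
Qed.

Lemma qform_eigen1 c s x y : c ^+ 2 + s ^+ 2 = 1 ->
  qform (spectral c s x y) (vec2 c s) = x.
Proof.
move=> cs1; rewrite qform_spectral !mxE /=.
transitivity (x * (c ^+ 2 + s ^+ 2) ^+ 2); first by ring.
by rewrite cs1 expr1n mulr1.
Qed.

Lemma qform_eigen2 c s x y : c ^+ 2 + s ^+ 2 = 1 ->
  qform (spectral c s x y) (vec2 (- s) c) = y.
Proof.
move=> cs1; rewrite qform_spectral !mxE /=.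
transitivity (y * (c ^+ 2 + s ^+ 2) ^+ 2); first by ring.
by rewrite cs1 expr1n mulr1.
Qed.

Lemma posdef_spectral c s x y : c ^+ 2 + s ^+ 2 = 1 -> 0 < x -> 0 < y ->
  posdef (spectral c s x y).
Proof.
move=> cs1 x0 y0; split=> [|v vn0]; first exact: trmx_spectral.
have {vn0} : 0 < sqnorm v by rewrite sqnorm_gt0.
rewrite -/(qform _ v) qform_spectral -(sqnorm_rot v cs1).
set k := (_ ^+ 2); set l := (_ ^+ 2) => kl.
have k0 : 0 <= k by exact: sqr_ge0.
have l0 : 0 <= l by exact: sqr_ge0.
have [k1|k1] := ltP 0 k.
  by apply: ltr_pwDl; [exact: mulr_gt0|apply: mulr_ge0 => //; exact: ltW].
have l1 : 0 < l by lra.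
by apply: ltr_wpDl; [apply: mulr_ge0 => //; exact: ltW|exact: mulr_gt0].
Qed.

Lemma posdef_ex_spectral X : posdef X ->
  exists c s x y, [/\ c ^+ 2 + s ^+ 2 = 1, 0 < y, y <= x & X = spectral c s x y].
Proof.
move=> [symX posX]; have [c [s [x [y [cs1 yx XE]]]]] := symmetric_spectral symX.
exists c, s, x, y; split=> //; rewrite -(qform_eigen2 x y cs1) -XE.
by apply: posX; rewrite -sqnorm_gt0 sqnorm_vec2 sqrrN addrC cs1.
Qed.

Lemma mpow_spectral r c s x y : c ^+ 2 + s ^+ 2 = 1 ->
  mpow r (spectral c s x y) = spectral c s (x `^ r) (y `^ r).
Proof. exact: mfun_spectral. Qed.

Lemma mlog_spectral c s x y : c ^+ 2 + s ^+ 2 = 1 ->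
  mlog (spectral c s x y) = spectral c s (ln x) (ln y).
Proof. exact: mfun_spectral. Qed.

Lemma posdef_mpow r X : posdef X -> posdef (mpow r X).
Proof.
move=> /posdef_ex_spectral [c [s [x [y [cs1 y0 yx ->]]]]].
by rewrite mpow_spectral //; apply: posdef_spectral; rewrite ?powR_gt0 // (lt_le_trans y0).
Qed.

Lemma mpow_mpow r t X : posdef X -> mpow r (mpow t X) = mpow (t * r) X.
Proof.
move=> /posdef_ex_spectral [c [s [x [y [cs1 y0 yx ->]]]]].
by rewrite !mpow_spectral // !powRrM.
Qed.

Lemma mpowD r t X : posdef X -> mpow (r + t) X = mpow r X *m mpow t X.
Proof.
move=> /posdef_ex_spectral [c [s [x [y [cs1 y0 yx ->]]]]].
have xn0 : x != 0 by rewrite gt_eqF // (lt_le_trans y0).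
by rewrite !mpow_spectral // mul_spectral // !powRD // ?xn0 ?(gt_eqF y0) ?implybT.
Qed.

Lemma mpow0 X : posdef X -> mpow 0 X = 1%:M.
Proof.
move=> /posdef_ex_spectral [c [s [x [y [cs1 y0 yx ->]]]]].
by rewrite !mpow_spectral // !powRr0 spectral_scalar.
Qed.

Lemma mpow1 X : posdef X -> mpow 1 X = X.
Proof.
move=> /posdef_ex_spectral [c [s [x [y [cs1 y0 yx ->]]]]].
by rewrite !mpow_spectral // !powRr1 // ltW // (lt_le_trans y0).
Qed.

Lemma invmx_mpow X : posdef X -> invmx X = mpow (-1) X.
Proof.
move=> pX; have h : X *m mpow (-1) X = 1%:M.
  by rewrite -[X in X *m _]mpow1 // -mpowD // subrr mpow0.
by have [uX _] := mulmx1_unit h; rewrite -[RHS](mulKmx uX) h mulmx1.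
Qed.

Lemma posdef_sym X : posdef X -> X^T = X.
Proof. by case. Qed.

Lemma posdef_congr X Y : posdef X -> posdef Y -> posdef (Y *m X *m Y).
Proof.
move=> [symX posX] pY; have symY := posdef_sym pY; split.
  by rewrite !trmx_mul symX symY mulmxA.
move=> v vn0; rewrite -/(qform _ v) qform_congr //; apply: posX.
apply: contra vn0 => /eqP Yv0.
(* [Y] is injective: [v = Y^-1 (Y v)], the inverse being written as a power. *)
rewrite -[v]mul1mx -(mpow0 pY) -(addNr 1) mpowD // mpow1 // -mulmxA Yv0.
by rewrite mulmx0.
Qed.

Lemma posdefD X Y : posdef X -> posdef Y -> posdef (X + Y).
Proof.
move=> [symX posX] [symY posY]; split=> [|v vn0]; first by rewrite linearD /= symX symY.
by rewrite -/(qform _ v) qformD addr_gt0 ?posX ?posY.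
Qed.

Lemma posdefZ x X : 0 < x -> posdef X -> posdef (x *: X).
Proof.
move=> x0 [symX posX]; split=> [|v vn0]; first by rewrite linearZ /= symX.
by rewrite -/(qform _ v) qformZ mulr_gt0 ?posX.
Qed.

(* [S G S] squares to [S Y S], where [S = X^(1/2)] and [Y = G X G]. *)
Lemma gmean_invmx X G : posdef X -> posdef G ->
  gmean (invmx X) (G *m X *m G) = G.
Proof.
move=> pX pG; rewrite /gmean invmx_mpow // !mpow_mpow //.
have -> : -1 * - (1 / 2) = 1 / 2 :> R by field.
have -> : -1 * (1 / 2) = - (1 / 2) :> R by field.
set S := mpow (1 / 2) X; set T := mpow (- (1 / 2)) X.
have SS : S *m S = X.
  by rewrite -mpowD // (_ : 1 / 2 + 1 / 2 = 1) ?mpow1 //; field.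
have TS : T *m S = 1%:M by rewrite -mpowD // addNr mpow0.
have ST : S *m T = 1%:M by rewrite -mpowD // subrr mpow0.
have pS : posdef S by exact: posdef_mpow.
have pSGS : posdef (S *m G *m S) by exact: posdef_congr.
have -> : S *m (G *m X *m G) *m S = mpow (1 + 1) (S *m G *m S).
  by rewrite (mpowD _ _ pSGS) (mpow1 pSGS) -SS !mulmxA.
rewrite (mpow_mpow _ _ pSGS) (_ : (1 + 1) * (1 / 2) = 1); last by field.
by rewrite (mpow1 pSGS) !mulmxA TS mul1mx -mulmxA ST mulmx1.
Qed.

(** With [P = G^-a X G^-a] the second argument is [G P G], so [gmean_invmx] yields [G], and
    [G^a P G^a] undoes the congruence. This allows the value of the mean to be prescribed before its
    arguments. *)
Lemma Fsg_mpow a X G : posdef X -> posdef G ->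
  Fsg a (mpow (- a) G *m X *m mpow (- a) G)
        (mpow (1 - a) G *m X *m mpow (1 - a) G) = X.
Proof.
move=> pX pG; set P := _ *m X *m mpow (- a) G.
have pP : posdef P by apply: posdef_congr => //; exact: posdef_mpow.
have -> : mpow (1 - a) G *m X *m mpow (1 - a) G = G *m P *m G.
  rewrite [in RHS]/P {1}mpowD // mpow1 // addrC mpowD // mpow1 // !mulmxA.
  by [].
rewrite /Fsg gmean_invmx // /P !mulmxA -mpowD // subrr mpow0 // mul1mx.
by rewrite -mulmxA -mpowD // addNr mpow0 // mulmx1.
Qed.

(** The bound by a scalar matrix says that the largest eigenvalue is at most [C]. It therefore
    passes to every power [r >= 0], including [r > 1], where powers are not operator monotone. *)
Lemma qform_mpow_le C r X v : posdef X -> 0 <= r ->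
  (forall u, qform X u <= C * sqnorm u) ->
  qform (mpow r X) v <= C `^ r * sqnorm v.
Proof.
move=> /posdef_ex_spectral [c [s [x [y [cs1 y0 yx ->]]]]] r0 XC.
have x0 : 0 < x by exact: lt_le_trans yx.
have xC : x <= C.
  by have := XC (vec2 c s); rewrite qform_eigen1 // sqnorm_vec2 cs1 mulr1.
rewrite mpow_spectral //; apply: le_trans (qform_spectral_le _ cs1 _) _.
  by apply: ge0_ler_powR; rewrite // nnegrE ltW.
rewrite ler_wpM2r ?addr_ge0 ?sqr_ge0 //.
by apply: ge0_ler_powR; rewrite // nnegrE ltW // (lt_le_trans x0).
Qed.

End PositiveDefinite.

(** * The counterexample family and its estimates, with constants independent of [l] where needed *)

Section Construction.
Variable R : realType.
Implicit Types (a c s x y r t g l : R) (X Y : 'M[R]_2) (v : 'cV[R]_2).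

Lemma not_loewner_le X Y v : qform Y v < qform X v -> ~ loewner_le X Y.
Proof.
move=> YX /(_ v); rewrite -/(qform _ _) qformB subr_ge0 leNgt => /negP; exact.
Qed.

Lemma spectralZ t c s x y : t *: spectral c s x y = spectral c s (t * x) (t * y).
Proof. by apply: mx2_eq; rewrite !mxE /=; ring. Qed.

Lemma sqnorm_mul Y v : Y^T = Y -> sqnorm (Y *m v) = qform (Y *m Y) v.
Proof.
move=> symY; rewrite -[X in X *m Y]mulmx1 qform_congr //.
rewrite -(@spectral_scalar _ 1 0) ?qform_spectral; last by ring.
by rewrite /sqnorm; ring.
Qed.

Lemma powRN_ge1 g t : 0 < g -> g <= 1 -> 0 <= t -> 1 <= g `^ (- t).
Proof.
move=> g0 g1 t0; rewrite powRN invf_ge1 ?powR_gt0 // -[leRHS](powRr0 g).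
by apply: ger_powR; rewrite ?g0.
Qed.

Lemma powR_le1 g t : 0 <= g -> g <= 1 -> 0 <= t -> g `^ t <= 1.
Proof.
move=> g0 g1 t0; have <- : 1 `^ t = 1 :> R by rewrite powR1.
by apply: ge0_ler_powR; rewrite ?nnegrE.
Qed.

Section Matrices.
Variables (a c s g l : R).
Hypotheses (a0 : 0 < a) (a1 : a < 1) (cs1 : c ^+ 2 + s ^+ 2 = 1).
Hypotheses (g0 : 0 < g) (g1 : g <= 1) (l1 : 1 <= l).

Let l0 : 0 < l. Proof. exact: lt_le_trans l1. Qed.

Let F := spectral 1 0 (l `^ (2 * a)) (l `^ (2 * a - 2)).
Let G := spectral c s l (l * g).
Let gam := g `^ (1 - a).

Let cs10 : 1 ^+ 2 + 0 ^+ 2 = 1 :> R. Proof. by ring. Qed.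

(** [F <= l^(2a)], while [G^(-2a)] has eigenvalues [l^(-2a)] and [l^(-2a) g^(-2a)]. The powers of
    [l] cancel, and [g <= 1] makes the second eigenvalue the larger. *)
Lemma qform_congr_neg_le v :
  qform (mpow (- a) G *m F *m mpow (- a) G) v <= g `^ (- (2 * a)) * sqnorm v.
Proof.
have l2a : 0 < l `^ (2 * a) by rewrite powR_gt0.
have symH : (mpow (- a) G)^T = mpow (- a) G by rewrite mpow_spectral // trmx_spectral.
rewrite qform_congr //; apply: le_trans (qform_spectral_le _ cs10 _) _.
  by apply: ler_powR => //; lra.
rewrite sqnorm_mul // /G mpow_spectral // mul_spectral //.
have powE x : 0 < x -> x `^ (- a) * x `^ (- a) = x `^ (- (2 * a)).
  by move=> x0; rewrite -powRD ?(gt_eqF x0) ?implybT //; congr (_ `^ _); ring.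
rewrite !powE ?mulr_gt0 // [(l * g) `^ _]powRM ?(ltW l0) ?(ltW g0) // qform_spectral.
have gE : g `^ (- (2 * a)) = l `^ (2 * a) * (l `^ (- (2 * a)) * g `^ (- (2 * a))).
  by rewrite mulrA -powRD ?(gt_eqF l0) ?implybT // subrr powRr0 mul1r.
rewrite [in leRHS]gE -[leRHS]mulrA ler_pM2l // -(sqnorm_rot v cs1) mulrDr lerD2r.
rewrite ler_wpM2r ?sqr_ge0 // ler_peMr ?powR_ge0 //.
by apply: powRN_ge1 => //; rewrite mulr_ge0 ?ltW.
Qed.

(** Each factor [G^(1-a)] releases a scalar [l^(1-a)], and [l^(2-2a) F = diag(l^2, 1)]. All
    dependence on [l] is thus in one diagonal entry. *)
Lemma congr_pos_scaled : mpow (1 - a) G *m F *m mpow (1 - a) G =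
  spectral c s 1 gam *m spectral 1 0 (l ^+ 2) 1 *m spectral c s 1 gam.
Proof.
have -> : mpow (1 - a) G = l `^ (1 - a) *: spectral c s 1 gam.
  by rewrite mpow_spectral // spectralZ mulr1 powRM ?ltW.
rewrite -!(scalemxAl, scalemxAr) scalerA.
have -> : spectral 1 0 (l ^+ 2) 1 = (l `^ (1 - a) * l `^ (1 - a)) *: F.
  have ln0 : (l != 0) by rewrite gt_eqF.
  rewrite spectralZ -!powRD ?ln0 ?implybT //.
  rewrite (_ : 1 - a + (1 - a) + 2 * a = 2%:R); last by ring.
  rewrite (_ : 1 - a + (1 - a) + (2 * a - 2) = 0); last by ring.
  by rewrite powRr0 powR_mulrn // ltW.
by rewrite -!(scalemxAl, scalemxAr).
Qed.
End Matrices.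

Section Stretched.
Variables (c s gam l : R).
Hypotheses (cs1 : c ^+ 2 + s ^+ 2 = 1) (gam0 : 0 < gam) (gam1 : gam <= 1).
Hypothesis (l1 : 1 <= l).

Let K := spectral c s 1 gam.
Let Q := K *m spectral 1 0 (l ^+ 2) 1 *m K.

Lemma qform_stretched v : qform Q v =
  l ^+ 2 * ((c ^+ 2 + gam * s ^+ 2) * v 0 0 + (1 - gam) * (c * s) * v 1 0) ^+ 2
  + (K *m v) 1 0 ^+ 2.
Proof.
rewrite qform_congr ?trmx_spectral // qform_spectral !mul1r !mul0r addr0 subr0.
by rewrite (mulmx2E _ v 0) !mxE /= mul1r.
Qed.

Lemma sqnorm_contract v : sqnorm (K *m v) <= sqnorm v.
Proof.
rewrite sqnorm_mul ?trmx_spectral // mul_spectral // mul1r.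
rewrite -[leRHS]mul1r qform_spectral_le //.
by rewrite mulr_ile1 // ltW.
Qed.

(** Each bound is a Rayleigh quotient estimate using that [K] is a contraction: at a vector that [K]
    maps onto the second axis, at the top eigenvector of [Q], and at [e1]. *)
Lemma stretched_eigen c' s' x y : c' ^+ 2 + s' ^+ 2 = 1 -> y <= x ->
  Q = spectral c' s' x y ->
  [/\ y <= 1, x <= l ^+ 2 & l ^+ 2 * c ^+ 4 <= x].
Proof.
move=> cs1' yx QE.
have Kv1 v : (K *m v) 1 0 ^+ 2 <= sqnorm v.
  by apply: le_trans (sqnorm_contract v); rewrite lerDr sqr_ge0.
have l2 : 1 <= l ^+ 2 by rewrite exprn_ege1.
split.
(* [v] is orthogonal to the first row of [K], which removes the [l^2] term. Its second entry is
   positive, also when [c = 0], since then [s^2 = 1]. *)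
- pose v := vec2 (- ((1 - gam) * (c * s))) (c ^+ 2 + gam * s ^+ 2).
  have nv0 : 0 < sqnorm v.
    rewrite sqnorm_vec2 ltr_wpDl ?sqr_ge0 // exprn_gt0 //.
    have [c0|c0] := eqVneq c 0.
      by move: cs1; rewrite c0 expr0n /= !add0r => ->; rewrite mulr1.
    by rewrite ltr_pwDl ?exprn_even_gt0 // mulr_ge0 ?sqr_ge0 // ltW.
  rewrite -(ler_pM2r nv0) mul1r.
  apply: le_trans (qform_spectral_ge v cs1' yx) _; rewrite -QE qform_stretched.
  have -> : (c ^+ 2 + gam * s ^+ 2) * v 0 0 + (1 - gam) * (c * s) * v 1 0 = 0.
    by rewrite !mxE /=; ring.
  by rewrite expr0n mulr0 add0r Kv1.
- rewrite -(qform_eigen1 x y cs1') -QE.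
  have K2 : qform Q (vec2 c' s') <= l ^+ 2 * sqnorm (K *m vec2 c' s').
    by rewrite qform_congr ?trmx_spectral // qform_spectral_le //; ring.
  apply: le_trans K2 _; rewrite ler_piMr ?(le_trans ler01) //.
  by apply: le_trans (sqnorm_contract _) _; rewrite sqnorm_vec2 cs1'.
- have -> : x = x * sqnorm (vec2 1 0) by rewrite sqnorm_vec2 expr0n expr1n addr0 mulr1.
  apply: le_trans (qform_spectral_le _ cs1' yx); rewrite -QE qform_stretched.
  rewrite !mxE /= mulr1 mulr0 addr0 ler_wpDr ?sqr_ge0 //.
  rewrite ler_wpM2l ?sqr_ge0 // (exprM c 2 2).
  have gs0 : 0 <= gam * s ^+ 2 by rewrite mulr_ge0 ?sqr_ge0 ?(ltW gam0).
  by rewrite ler_sqr ?nnegrE ?sqr_ge0 ?lerDl // addr_ge0 ?sqr_ge0.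
Qed.
End Stretched.

(** Testing the mean at the low eigenvector of [Q] gives [n <= (1 - a) C^r + a y^r <= C^r]. Testing
    it at its own low eigenvector and keeping only the top spectral term of [Q^r] gives the second
    bound: a large [x] forces near orthogonality to the top eigenvector of [Q]. *)
Lemma mean_eigen_le (a r C : R) P Q (c s x y c' s' m n : R) :
  0 < a -> a < 1 -> 0 <= r -> 1 <= C ->
  posdef P -> (forall v, qform P v <= C * sqnorm v) ->
  c ^+ 2 + s ^+ 2 = 1 -> 0 <= y -> y <= 1 -> 0 <= x -> Q = spectral c s x y ->
  c' ^+ 2 + s' ^+ 2 = 1 -> n <= m ->
  (1 - a) *: mpow r P + a *: mpow r Q = spectral c' s' m n ->
  n <= C `^ r /\ a * (x `^ r * (c * - s' + s * c') ^+ 2) <= C `^ r.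
Proof.
move=> a0 a1 r0 C1 pP PC cs1 y0 y1 x0 QE cs1' nm ME.
have Cr : 1 <= C `^ r by rewrite -(powRr0 C) ler_powR.
have yr : y `^ r <= 1 by exact: powR_le1.
have nC : n <= C `^ r.
  have := qform_spectral_ge (vec2 (- s) c) cs1' nm.
  rewrite -ME qformD !qformZ QE mpow_spectral // qform_eigen2 //.
  have := qform_mpow_le (vec2 (- s) c) pP r0 PC.
  rewrite sqnorm_vec2 sqrrN [s ^+ 2 + _]addrC cs1 !mulr1.
  by nra.
split=> //; apply: le_trans nC.
rewrite -[leRHS](qform_eigen2 m n cs1') -ME qformD !qformZ.
rewrite QE mpow_spectral // qform_spectral !mxE /=.
have pPr : 0 <= qform (mpow r P) (vec2 (- s') c').
  have [_ /(_ (vec2 (- s') c')) h] := posdef_mpow r pP.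
  by apply/ltW/h; rewrite -sqnorm_gt0 sqnorm_vec2 sqrrN addrC cs1'.
rewrite mulrDr addrCA lerDl addr_ge0 // mulr_ge0 ?(ltW a0) ?subr_ge0 ?(ltW a1) //.
by rewrite mulr_ge0 ?powR_ge0 ?sqr_ge0.
Qed.

(* [k] is the component along [e1] of [(E + gam (1 - E)) z], where [E] is the
   projection onto the line of [(c, s)]. *)
Lemma direction_bound (a c s gam z0 z1 : R) : 0 < a -> a < 1 ->
  c ^+ 2 = a / 16 -> c ^+ 2 + s ^+ 2 = 1 -> gam = a / 40 -> z0 ^+ 2 + z1 ^+ 2 = 1 ->
  ((c ^+ 2 + gam * s ^+ 2) * z0 + (1 - gam) * (c * s) * z1) ^+ 2 <= 2 * gam ^+ 2 ->
  z1 ^+ 2 <= a / 2.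
Proof.
move=> a0 a1 c2 cs1 gamE z1E; set k := (_ + _ * z1) => k2.
(* In these rotated coordinates [k = c W - gam s V]. A small [k] makes [c W] small, and
   [s z1 = W - c z0] then makes [z1] small; both steps use [(x + y)^2 <= 2 x^2 + 2 y^2]. *)
pose W := c * z0 + s * z1; pose V := c * z1 - s * z0.
have s2 : s ^+ 2 = 1 - a / 16 by rewrite -c2 -cs1; ring.
have WV : W ^+ 2 + V ^+ 2 = 1.
  by rewrite /W /V -(mulr1 1) -{1}cs1 -z1E; ring.
have cW : c * W = k + s * gam * V by rewrite /k /W /V; ring.
have sz : s * z1 = W - c * z0 by rewrite /W; ring.
have c2W2 : c ^+ 2 * W ^+ 2 <= 2 * k ^+ 2 + 2 * gam ^+ 2.
  rewrite -exprMn cW.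
  have : 0 <= (k - s * gam * V) ^+ 2 by exact: sqr_ge0.
  have : (s * gam * V) ^+ 2 <= gam ^+ 2.
    rewrite !exprMn [s ^+ 2 * _]mulrC -mulrA ler_piMr ?sqr_ge0 //.
    have := sqr_ge0 W; have := sqr_ge0 V; have := sqr_ge0 c; nra.
  by nra.
have s2z2 : s ^+ 2 * z1 ^+ 2 <= 2 * W ^+ 2 + 2 * c ^+ 2.
  rewrite -exprMn sz.
  have : 0 <= (W + c * z0) ^+ 2 by exact: sqr_ge0.
  have : (c * z0) ^+ 2 <= c ^+ 2.
    rewrite exprMn ler_piMr ?sqr_ge0 //; have := sqr_ge0 z1; lra.
  by nra.
have : c ^+ 2 * (s ^+ 2 * z1 ^+ 2) <= 4 * k ^+ 2 + 4 * gam ^+ 2 + 2 * c ^+ 2 * c ^+ 2.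
  have := sqr_ge0 c; nra.
rewrite c2 s2; move: k2; rewrite gamE => k2.
have := sqr_ge0 z1; set Z := z1 ^+ 2 => Z0 h.
(* On the left, [s^2 = 1 - a/16 >= 15/16]. On the right, [4 k^2 + 4 gam^2 <= 12 gam^2 = 12 a^2 /
   1600] and [2 c^4 = 2 a^2 / 256]. *)
have h1 : a / 16 * ((15 / 16) * Z) <= a * a * (12 / 1600 + 2 / 256).
  have : a / 16 * (15 / 16 * Z) <= a / 16 * ((1 - a / 16) * Z).
    by apply: ler_wpM2l; [lra|apply: ler_wpM2r => //; lra].
  lra.
have h2 : a * (15 / 256 * Z) <= a * (a * (12 / 1600 + 2 / 256)) by lra.
rewrite (ler_pM2l a0) in h2; lra.
Qed.

Lemma ex_scale (a p r g gam C c : R) : 0 < a -> 0 < p -> 0 < r -> 0 < g -> 0 < gam ->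
  0 < C -> c != 0 ->
  exists l, [/\ 1 <= l, 1 <= l ^+ 2 * gam ^+ 2,
    C `^ r / (a * gam ^+ 2) <= (l ^+ 2 * c ^+ 4) `^ r,
    0 < ln l + 2 * ln g & 2 < (l * g) `^ (2 * a / p)].
Proof.
move=> a0 p0 r0 g0 gam0 C0 c0.
have c4 : 0 < c ^+ 4 by rewrite exprn_even_gt0.
have gam2 : 0 < gam ^+ 2 by rewrite exprn_gt0.
set D := C `^ r / (a * gam ^+ 2).
have D0 : 0 < D by rewrite divr_gt0 ?powR_gt0 ?mulr_gt0.
set x1 := (gam ^+ 2)^-1; have x10 : 0 < x1 by rewrite invr_gt0.
set x2 := D `^ (1 / r) / c ^+ 4; have x20 : 0 < x2 by rewrite divr_gt0 ?powR_gt0.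
set x3 := (g ^+ 2)^-1; have x30 : 0 < x3 by rewrite invr_gt0 exprn_gt0.
set x4 := 2 `^ (p / (2 * a)) / g; have x40 : 0 < x4 by rewrite divr_gt0 ?powR_gt0.
(* The summand [1] gives [l >= 1], hence [l <= l^2], and makes [l] exceed each [xi] strictly; [x1]
   to [x4] serve the four remaining requirements in order. *)
pose l := 1 + x1 + x2 + x3 + x4.
have l1 : 1 <= l by rewrite /l; lra.
have l0 : 0 < l by lra.
have ll2 : l <= l ^+ 2 by rewrite expr2 ler_peMr // ltW.
exists l; split => //.
- rewrite -ler_pdivrMr // div1r; apply: le_trans ll2; rewrite -/x1 /l; lra.
- have -> : D = (D `^ (1 / r)) `^ r by rewrite -powRrM mul1r mulVf ?gt_eqF // powRr1 // ltW.
  have lc0 : 0 <= l ^+ 2 * c ^+ 4 by apply: mulr_ge0; [exact: sqr_ge0|exact: ltW].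
  apply: ge0_ler_powR; rewrite ?nnegrE ?powR_ge0 ?(ltW r0) //.
  rewrite -ler_pdivrMr //; apply: le_trans ll2; rewrite -/x2 /l; lra.
- have -> : 2 * ln g = ln (g ^+ 2) by rewrite lnXn // mulr_natl.
  rewrite -lnM ?posrE ?exprn_gt0 // ln_gt0 // -ltr_pdivrMr ?exprn_gt0 // div1r -/x3 /l; lra.
- have {1}-> : 2 = (2 `^ (p / (2 * a))) `^ (2 * a / p) :> R.
    rewrite -powRrM (_ : _ * _ = 1) ?powRr1 //.
    by field; rewrite !gt_eqF.
  have lg0 : 0 <= l * g by apply: mulr_ge0; exact: ltW.
  apply: gt0_ltr_powR; rewrite ?nnegrE ?powR_ge0 ?divr_gt0 ?mulr_gt0 //.
  rewrite -ltr_pdivrMr // -/x4 /l; lra.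
Qed.

(** The equation is the form of [Q] at one vector, computed from the product and from the
    eigenbasis. Its right side is at most [L d + 1 <= 2 L d]. *)
Lemma stretched_component_le (L d x y u u' k w : R) :
  L * k ^+ 2 + w ^+ 2 = x * u ^+ 2 + y * u' ^+ 2 -> u ^+ 2 + u' ^+ 2 = 1 ->
  0 < L -> 0 <= x -> x <= L -> 0 <= y -> y <= 1 -> u ^+ 2 <= d -> 1 <= L * d ->
  k ^+ 2 <= 2 * d.
Proof.
move=> kE uu' L0 x0 xL y0 y1 ud Ld.
have h1 : x * u ^+ 2 <= L * d by apply: ler_pM; rewrite ?sqr_ge0.
have u'1 : u' ^+ 2 <= 1 by rewrite -uu' lerDr sqr_ge0.
have h2 : y * u' ^+ 2 <= 1 by rewrite mulr_ile1 ?sqr_ge0.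
rewrite -(ler_pM2l L0); have := sqr_ge0 w; lra.
Qed.

(** Meant for [x = ln l], [y = ln g] and [t = z1^2]: the coefficient of [x] on the right is at least
    [a], and [a x > - 2 a y]. *)
Lemma log_gap (a t x y : R) : 0 < a -> t <= a / 2 -> 0 <= x -> 0 < x + 2 * y ->
  - (2 * a) * y < (2 * a - 2 * t) * x.
Proof.
move=> a0 ta x0 xy.
have h1 : a * x <= (2 * a - 2 * t) * x by apply: ler_wpM2r => //; lra.
have : 0 < a * (x + 2 * y) by rewrite mulr_gt0.
lra.
Qed.

End Construction.

(** * Choice of the constants, and refutation of both orders at a single eigenvector *)

Theorem theorem4p23 (R : realType) (a p q : R) :
  0 < a -> a < 1 -> 0 < p -> 0 < q ->
  exists A B : 'M[R]_2,
    posdef A /\ posdef B /\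
    ~ chao_le (SG a p A B) (Amean a q A B) /\
    ~ loewner_le (SG a p A B) (Amean a q A B).
Proof.
move=> a0 a1 p0 q0.
pose c := Num.sqrt (a / 16); pose s := Num.sqrt (1 - a / 16).
(* [g] is chosen so that [g^(1-a) = gam], the value of [gam] that [direction_bound] requires. *)
pose gam := a / 40; pose g := gam `^ (1 / (1 - a)).
have c2 : c ^+ 2 = a / 16 by rewrite sqr_sqrtr //; lra.
have cs1 : c ^+ 2 + s ^+ 2 = 1 by rewrite c2 sqr_sqrtr; lra.
have gam0 : 0 < gam by rewrite /gam; lra.
have gam1 : gam <= 1 by rewrite /gam; lra.
have g0 : 0 < g by rewrite powR_gt0.
have g1 : g <= 1.
  apply: powR_le1 => //; first exact: ltW.
  by rewrite divr_ge0 //; lra.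
have gamE : g `^ (1 - a) = gam.
  by rewrite -powRrM (_ : _ * _ = 1) ?powRr1 ?ltW //; field; lra.
move: g g0 g1 gamE => g g0 g1 gamE.
(* With [A = P^(1/p)] and [B = Q^(1/p)] one has [A^q = P^r] and [B^q = Q^r]. *)
pose r := 1 / p * q; pose C := g `^ (- (2 * a)).
have r0 : 0 < r by rewrite mulr_gt0 // divr_gt0.
have C0 : 0 < C by rewrite powR_gt0.
have C1 : 1 <= C by apply: powRN_ge1 => //; lra.
have cn0 : c != 0 by rewrite -sqrf_eq0 c2 gt_eqF //; lra.
have [l [l1 lgam lD lln l2]] := ex_scale a0 p0 r0 g0 gam0 C0 cn0.
have l0 : 0 < l by exact: lt_le_trans l1.
pose F := spectral 1 0 (l `^ (2 * a)) (l `^ (2 * a - 2)).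
pose G := spectral c s l (l * g).
have cs10 : 1 ^+ 2 + 0 ^+ 2 = 1 :> R by ring.
have pF : posdef F by apply: posdef_spectral; rewrite ?powR_gt0.
have pG : posdef G by apply: posdef_spectral; rewrite ?mulr_gt0.
pose P := mpow (- a) G *m F *m mpow (- a) G.
pose Q := mpow (1 - a) G *m F *m mpow (1 - a) G.
have pP : posdef P by apply: posdef_congr => //; exact: posdef_mpow.
have pQ : posdef Q by apply: posdef_congr => //; exact: posdef_mpow.
have FPQ : Fsg a P Q = F by exact: Fsg_mpow.
have QK : Q = spectral c s 1 gam *m spectral 1 0 (l ^+ 2) 1 *m spectral c s 1 gam.
  by rewrite -gamE; exact: congr_pos_scaled.
have PC v : qform P v <= C * sqnorm v by exact: qform_congr_neg_le.
move: P Q pP pQ FPQ QK PC => P Q pP pQ FPQ QK PC.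
pose M := (1 - a) *: mpow r P + a *: mpow r Q.
have pM : posdef M.
  by apply: posdefD; apply: posdefZ; rewrite ?subr_gt0 //; exact: posdef_mpow.
exists (mpow (1 / p) P), (mpow (1 / p) Q); do 2 (split; first exact: posdef_mpow).
have mpowK X : posdef X -> mpow p (mpow (1 / p) X) = X.
  by move=> pX; rewrite mpow_mpow // mul1r mulVf ?gt_eqF // mpow1.
have -> : SG a p (mpow (1 / p) P) (mpow (1 / p) Q) = mpow (1 / p) F.
  by rewrite /SG (mpowK P pP) (mpowK Q pQ) FPQ.
have -> : Amean a q (mpow (1 / p) P) (mpow (1 / p) Q) = mpow (1 / q) M.
  by rewrite /Amean (mpow_mpow q _ pP) (mpow_mpow q _ pQ).
have [cQ [sQ [x [y [csQ y0 yx QE]]]]] := posdef_ex_spectral pQ.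
have [cM [sM [m [n [csM n0 nm ME]]]]] := posdef_ex_spectral pM.
have [y1 xl lx] : [/\ y <= 1, x <= l ^+ 2 & l ^+ 2 * c ^+ 4 <= x].
  by apply: (stretched_eigen cs1 gam0 gam1 l1 csQ yx); rewrite -QK.
have x0 : 0 < x by exact: lt_le_trans yx.
have [nC xC] := mean_eigen_le a0 a1 (ltW r0) C1 pP PC csQ (ltW y0) y1 (ltW x0) QE csM nm ME.
(* [z] is the unit eigenvector of [M] for its least eigenvalue [n], and [u] is its component along
   the top eigenvector of [Q]. *)
pose z := vec2 (- sM) cM; pose u := cQ * - sM + sQ * cM.
have nz : sqnorm z = 1 by rewrite sqnorm_vec2 sqrrN addrC.
have z0E : z 0 0 = - sM by rewrite mxE.
have z1E : z 1 0 = cM by rewrite mxE.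
(* The choice of [l] gives [a x^r u^2 <= C^r <= a x^r gam^2]. *)
have u2 : u ^+ 2 <= gam ^+ 2.
  have Dx : C `^ r / (a * gam ^+ 2) <= x `^ r.
    apply: le_trans lD _; apply: ge0_ler_powR => //; rewrite ?nnegrE ?(ltW r0) ?(ltW x0) //.
    by rewrite mulr_ge0 ?exprn_even_ge0.
  have ag : 0 < a * gam ^+ 2 by rewrite mulr_gt0 ?exprn_gt0.
  rewrite ler_pdivrMr // in Dx.
  have axr : 0 < a * x `^ r by rewrite mulr_gt0 ?powR_gt0.
  rewrite -(ler_pM2l axr); apply: le_trans (_ : C `^ r <= _).
    by rewrite -mulrA.
  by apply: le_trans Dx _; rewrite mulrCA mulrA.
have kz : ((c ^+ 2 + gam * s ^+ 2) * (- sM) + (1 - gam) * (c * s) * cM) ^+ 2 <= 2 * gam ^+ 2.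
  have := qform_stretched c s gam l z; rewrite -QK QE qform_spectral z0E z1E -/u.
  set k := (_ + _ * cM); set u' := (cQ * cM - _) => /esym kE.
  have uu' : u ^+ 2 + u' ^+ 2 = 1.
    by have := sqnorm_rot z csQ; rewrite nz z0E z1E.
  apply: (stretched_component_le kE uu' _ (ltW x0) xl (ltW y0) y1 u2 lgam).
  by rewrite exprn_gt0.
have cM2 : cM ^+ 2 <= a / 2.
  by apply: (direction_bound a0 a1 c2 cs1 erefl _ kz); rewrite sqrrN addrC.
have sM2 : sM ^+ 2 = 1 - cM ^+ 2 by rewrite -csM; ring.
have p_n0 : p != 0 by rewrite gt_eqF.
have q_n0 : q != 0 by rewrite gt_eqF.
split; apply: (not_loewner_le (v := z)).
(* The intermediate value is [(ln C) / p]: the mean contributes [(ln n) / q <= (r / q) ln C], and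
   [r / q = 1 / p]. *)
- apply: (@le_lt_trans _ _ (1 / p * (- (2 * a) * ln g))).
    rewrite ME mpow_spectral // mlog_spectral // qform_eigen2 // ln_powR.
    rewrite [leRHS](_ : _ = 1 / q * (r * (- (2 * a) * ln g))).
      by rewrite ler_pM2l ?divr_gt0 // -!ln_powR ler_ln ?posrE ?powR_gt0.
    by rewrite /r; field; rewrite p_n0 q_n0.
  rewrite (mpow_spectral _ _ _ cs10) (mlog_spectral _ _ cs10) qform_spectral z0E z1E !ln_powR.
  rewrite [ltRHS](_ : _ = 1 / p * ((2 * a - 2 * cM ^+ 2) * ln l)); last by ring: sM2.
  by rewrite ltr_pM2l ?divr_gt0 // (log_gap a0 cM2 (ln_ge0 l1) lln).
(* The Loewner order is refuted directly at the same [z], with [C^(1/p)] in between. After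
   multiplication by [g^(2a/p)] the claim follows from [(l g)^(2a/p) > 2] and [sM^2 >= 1/2]. *)
- apply: (@le_lt_trans _ _ (g `^ (- (2 * a / p)))).
    rewrite ME mpow_spectral // qform_eigen2 //.
    apply: le_trans (_ : (C `^ r) `^ (1 / q) <= _).
      by apply: ge0_ler_powR; rewrite ?nnegrE ?powR_ge0 ?(ltW n0) ?divr_ge0 ?(ltW q0).
    rewrite /C /r -!powRrM le_eqVlt; apply/orP; left; apply/eqP; congr (_ `^ _).
    by field; rewrite p_n0 q_n0.
  rewrite mpow_spectral // qform_spectral z0E z1E !mul1r !mul0r addr0 subr0 sqrrN.
  rewrite -!powRrM.
  have gp0 : 0 < g `^ (2 * a / p) by rewrite powR_gt0.
  apply: lt_le_trans (_ : l `^ (2 * a / p) * sM ^+ 2 <= _); last first.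
    by rewrite lerDl mulr_ge0 ?powR_ge0 ?sqr_ge0.
  rewrite powRN -(ltr_pM2l gp0) mulfV ?(gt_eqF gp0) // mulrA [g `^ _ * _]mulrC.
  rewrite -powRM ?(ltW l0) ?(ltW g0) //.
  have sM_half : 1 <= 2 * sM ^+ 2 by rewrite sM2; move: cM2 a1; clear; lra.
  have sM2_gt0 : 0 < sM ^+ 2 by move: sM_half; clear; lra.
  by apply: le_lt_trans sM_half _; rewrite ltr_pM2r.
Qed.
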